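(* Let $\alpha>0$ and $S_\alpha=\{m+n\alpha:m,n\in\mathbb{N}\}$. (a) Suppose $\alpha\notin\mathcal{D}$ and $\mu\in\mathcal{P}^B_{S_\alpha}$. If the coefficients $b_\beta$ in the expansion $\mu|_{x\ge R}(dx)=\sum_{\beta\in S_\alpha,\beta>0}b_\beta\left(\frac1x\right)^{\beta+1}dx$ are zero for all $\beta\in\mathbb{N}$, then $\mu\in\mathcal{P}_{S_\alpha}$. (b) Conversely, if $\alpha\in\mathcal{D}$, then there exists a probability measure $\mu\in\mathcal{P}^B_{S_\alpha}$ with $b_\beta=0$ for all $\beta\in\mathbb{N}$ such that $\mu\notin\mathcal{P}_{S_\alpha}$.
   Context: $\mathbb{N}=\{0,1,2,\dots\}$. The set $S=S_\alpha$ is an additive sub-semigroup of $[0,\infty)$ satisfying: (S1) $\mathbb{N}\subset S$; (S2) there is a constant $c>0$ such that $\sharp(S\cap[n,n+1))\le c^{n+1}$ for every $n\in\mathbb{N}$. Such a constant $c$ is fixed. The class $\mathcal{P}_S$: a probability measure $\mu$ on $\mathbb{R}$ belongs to $\mathcal{P}_S$ if there exist $\{a_\beta\}_{\beta\in S,\beta>0}\subset\mathbb{C}$ and $r,R>0$ such that the restriction of $\mu$ to $\{|x|\ge R\}$ is $$\mu|_{|x|\ge R}(dx)=\sum_{\beta\in S,\,\beta>0}\mathrm{Im}\left(a_\beta\left(\tfrac1x\right)^{\beta+1}\right)dx,$$ with $|a_\beta|\le r^\beta$ for all $\beta$ and $r<c^{-1}R$. Here $(1/x)^{\beta+1}$ is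 understood as $e^{i(\beta+1)\pi}|x|^{-\beta-1}$ for $x\le -R$ (and as the usual positive power for $x\ge R$). The class $\mathcal{P}^B_S$: it consists of all probability measures $\mu$ on $\mathbb{R}$ such that (1) the support of $\mu$ is bounded below; (2) there exist $\{b_\beta\}_{\beta\in S,\beta>0}\subset\mathbb{R}$ and $r,R>0$ such that $$\mu|_{x\ge R}(dx)=\sum_{\beta\in S,\,\beta>0}b_\beta\left(\tfrac1x\right)^{\beta+1}dx,\qquad |b_\beta|\le r^\beta,\qquad r<c^{-1}R.$$ The set $\mathcal{D}$: the set of all irrational real numbers $\beta$ such that for every $b>1$ the inequality $\left|\beta-\frac pq\right|<b^{-q}$ holds for infinitely many pairs $(p,q)\in\mathbb{Z}\times(\mathbb{N}\setminus\{0\})$. (Thus $\alpha\notin\mathcal{D}$ includes the case of rational $\alpha$.) *)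

(* Defs.v *)
From mathcomp Require Import all_boot all_order all_algebra.
From mathcomp Require Import finmap.
From mathcomp Require Import all_classical all_reals all_analysis.
From mathcomp Require Import complex.

Set Implicit Arguments.
Unset Strict Implicit.
Unset Printing Implicit Defensive.

Import Order.TTheory GRing.Theory Num.Theory.
Import numFieldNormedType.Exports.

Local Open Scope classical_set_scope.
Local Open Scope ring_scope.
Local Open Scope complex_scope.

Definition S_ (R : realType) (alpha : R) : set R :=
  [set x | exists m n : nat, x = m%:R + n%:R * alpha].

(* [fset_set] sends infinite sets to the empty one, hence the explicit
   finiteness requirement in the counting condition. *)
Definition admissible (R : realType) (S : set R) (c : R) : Prop :=
  [/\ 0 < c,
      S `<=` [set x | 0 <= x],
      (forall x y, S x -> S y -> S (x + y)),
      (forall n : nat, S n%:R) &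
      forall n : nat, let A := S `&` `[n%:R, n.+1%:R[%classic in
        finite_set A /\ (#|` fset_set A|)%:R <= c ^+ n.+1].

(* Sum of a real family over the set of indices D, as positive part minus
   negative part; it is only used for absolutely summable families. *)
Definition sum_over (R : realType) (D : set R) (f : R -> R) : \bar R :=
  (\esum_(i in D) ((EFin \o f)^\+ i) - \esum_(i in D) ((EFin \o f)^\- i))%E.

Definition has_density_on (R : realType)
    (mu : probability (measurableTypeR R) R) (D : set R) (g : R -> \bar R) :
    Prop :=
  forall A : set (measurableTypeR R), measurable A ->
    mu (A `&` D) = (\int[@lebesgue_measure R]_(x in A `&` D) g x)%E.

(* (1/x)^s for real s, with the branch e^(i s pi) |x|^(-s) for x < 0. *)
Definition inv_cpow (R : realType) (x s : R) : R[i] :=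
  if 0 <= x then (x `^ (- s))%:C
  else (cos (s * pi) +i* sin (s * pi)) * (`|x| `^ (- s))%:C.

Definition two_sided_expansion (R : realType) (S : set R) (c : R)
    (mu : probability (measurableTypeR R) R) (a : R -> R[i]) (r R0 : R) : Prop :=
  [/\ 0 < r /\ 0 < R0,
      r < c^-1 * R0,
      (forall b, S b -> 0 < b -> `|a b| <= (r `^ b)%:C) &
      has_density_on mu [set x | R0 <= `|x|]
        (fun x => sum_over (S `&` [set b | 0 < b])
                    (fun b => complex.Im (a b * inv_cpow x (b + 1))))].

Definition class_P (R : realType) (S : set R) (c : R)
    (mu : probability (measurableTypeR R) R) : Prop :=
  exists (a : R -> R[i]) (r R0 : R), two_sided_expansion S c mu a r R0.

Definition right_expansion (R : realType) (S : set R) (c : R)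
    (mu : probability (measurableTypeR R) R) (b : R -> R) (r R0 : R) : Prop :=
  [/\ 0 < r /\ 0 < R0,
      r < c^-1 * R0,
      (forall t, S t -> 0 < t -> `|b t| <= r `^ t) &
      has_density_on mu [set x | R0 <= x]
        (fun x => sum_over (S `&` [set t | 0 < t])
                    (fun t => b t * x^-1 `^ (t + 1)))].

Definition msupport (R : realType)
    (mu : probability (measurableTypeR R) R) : set R :=
  [set x | forall U : set R, open U -> U x -> (0 < mu U)%E].

Definition class_PB (R : realType) (S : set R) (c : R)
    (mu : probability (measurableTypeR R) R) : Prop :=
  has_lbound (msupport mu) /\
  exists (b : R -> R) (r R0 : R), right_expansion S c mu b r R0.

Definition in_D (R : realType) (beta : R) : Prop :=
  irrational beta /\
  forall b : R, 1 < b ->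
    infinite_set [set pq : int * nat |
      (0 < pq.2)%N /\ `|beta - pq.1%:~R / pq.2%:R| < b ^- pq.2].

(* Main.v *)
From HB Require Import structures.
Require Import Defs.
From mathcomp Require Import all_boot all_order all_algebra.
From mathcomp Require Import all_classical all_reals all_analysis.
From mathcomp Require Import measurable_realfun complex ring lra.

(** Write [th = (t + 1) pi].  The density on the negative half-line vanishes iff
    [Im (a_t e^(i th)) = 0] for every [t], and the density on the positive
    half-line forces [Im a_t = b_t]; together they determine
    [a_t = - b_t cot th + i b_t], of modulus [|b_t| / |sin (pi t)|].  So
    everything hinges on whether [|sin (pi (m + n alpha))|], which is comparable
    to the distance from [n alpha] to the integers, is bounded below by some
    [rho^(-n)] when it is not zero, and this is what [alpha] not in D says.

    For (a) one takes these [a_t] and enlarges [R0] beyond the left end of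
    the support. For (b) one takes [b_(n alpha) = 1] for [n >= 1] and [b_t =
    0] otherwise, whose density sums to [x^(-alpha-1) / (1 - x^(-alpha))],
    with the missing mass spread on [[0, 1]]. Uniqueness of the coefficients
    comes from comparing leading terms: two different expansions differ by a
    constant sign on all far enough unit intervals. *)

Set Implicit Arguments.
Unset Strict Implicit.
Unset Printing Implicit Defensive.

Import Order.TTheory GRing.Theory Num.Theory.
Import numFieldNormedType.Exports.
Local Open Scope classical_set_scope.
Local Open Scope ring_scope.

(** * Diophantine and sine lower bounds *)

(** Used twice: to bound the nonzero distances of finitely many approximations away from 0, and to
    find the gap after a point of [S_ alpha]. *)
Lemma finite_gap (R : realType) (F : set R) (t : R) : finite_set F ->
  exists2 e : R, 0 < e & forall x, F x -> t < x -> t + e <= x.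
Proof.
move=> /finite_seqP[s ->] {F}.
elim: s => [|y s [e e0 IH]]; first by exists 1 => // x; rewrite /= in_nil.
have [ty|yt] := ltP t y.
  exists (Num.min e (y - t)); first by rewrite lt_min e0 subr_gt0.
  move=> x /=; rewrite inE => /predU1P[->|xs] tx.
    by rewrite -lerBrDl ge_min lexx orbT.
  by apply: le_trans (IH x xs tx); rewrite lerD2l ge_min lexx.
exists e => // x /=; rewrite inE => /predU1P[->|/IH //].
by rewrite ltNge yt.
Qed.

Lemma irrational_mul_neq_int (R : realType) (x : R) (p : int) (q : nat) :
  irrational x -> (0 < q)%N -> q%:R * x != p%:~R.
Proof.
move=> xirr q0; apply/eqP => qx; apply: xirr.
exists (p%:~R / q%:R) => //.
rewrite fmorph_div/= ratr_int ratr_nat -qx mulrC mulKf//.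
by rewrite pnatr_eq0 -lt0n.
Qed.

(** For rational [x], the number [n x - k] is an integer over the denominator of [x], so [B = 1]
    works. For irrational [x], some base [b] admits only finitely many pairs closer than [b^-q]:
    those pairs have a positive minimal distance, and any other pair satisfies
    [|n x - k| >= n b^-n >= b^-n]. *)
Lemma not_in_D_lower_bound (R : realType) (x : R) : ~ in_D x ->
  exists K B : R, [/\ 0 < K, 1 <= B & forall (n : nat) (k : int), (0 < n)%N ->
    n%:R * x != k%:~R -> K * B ^- n <= `|n%:R * x - k%:~R|].
Proof.
move=> xD; have [xirr|] := pselect (irrational x); last first.
  rewrite /irrational/= => /contrapT[q _ <-].
  exists (`|denq q|%:~R^-1), 1; split => //.
    by rewrite invr_gt0 ltr0z normr_gt0 denq_neq0.
  move=> n k n0 nk; rewrite expr1n invr1 mulr1.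
  have dq0 : (denq q)%:~R != 0 :> R by rewrite intr_eq0 denq_neq0.
  have -> : n%:R * ratr q - k%:~R =
      (n%:Z * numq q - k * denq q)%:~R / (denq q)%:~R :> R.
    rewrite /ratr rmorphB/= !rmorphM/=; field.
    exact: dq0.
  rewrite normrM normfV -!intr_norm -[X in X <= _]mul1r ler_wpM2r//.
  rewrite -[1]/(1%:~R) ler_int -gtz0_ge1 normr_gt0.
  apply: contra nk => /eqP; rewrite -(inj_eq (mulIf dq0)) => e.
  rewrite /ratr mulrA mulfVK//.
  by rewrite -[n%:R]/(n%:~R) -!intrM eqr_int -subr_eq0 e.
have [b [b1 finb]] : exists b : R, 1 < b /\ finite_set [set pq : int * nat |
      (0 < pq.2)%N /\ `|x - pq.1%:~R / pq.2%:R| < b ^- pq.2].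
  apply: contrapT => H; apply: xD; split => // b b1 fb; apply: H.
  by exists b.
(* [e] bounds from below every nonzero [|q x - p|] over the finitely many exceptional pairs. *)
have [e e0 He] := finite_gap 0
  (finite_image (fun pq : int * nat => `|pq.2%:R * x - pq.1%:~R|) finb).
exists (Num.min e 1), b; split; [by rewrite lt_min e0/=|exact: ltW|].
move=> n k n0 nk; have b0 := lt_trans ltr01 b1.
have bn1 : b ^- n <= 1.
  by rewrite invf_le1 ?exprn_gt0// exprn_ege1// ltW.
have [near|far] := ltP `|x - k%:~R / n%:R| (b ^- n).
  have : e <= `|n%:R * x - k%:~R|.
    rewrite -[e]add0r; apply: He; first by exists (k, n).
    by rewrite normr_gt0 subr_eq0.
  apply: le_trans; rewrite -[leRHS]mulr1 ler_pM// ?ge_min ?lexx//.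
  - by rewrite le_min (ltW e0) ler01.
  - by rewrite invr_ge0 exprn_ge0// ltW.
have n0R : 0 < n%:R :> R by rewrite ltr0n.
have -> : n%:R * x - k%:~R = n%:R * (x - k%:~R / n%:R).
  by field; rewrite gt_eqF.
rewrite normrM gtr0_norm//; apply: ler_pM => //.
- by rewrite le_min (ltW e0) ler01.
- by rewrite invr_ge0 exprn_ge0// ltW.
- by rewrite ge_min ler1n n0 orbT.
Qed.

Lemma abs_sin_le (R : realType) (x : R) : `|sin x| <= `|x|.
Proof.
wlog x0 : x / 0 < x => [H|].
  have [|x0|<-] := ltgtP 0 x; [exact: H| |by rewrite sin0 normr0].
  by rewrite -normrN -sinN -[leRHS]normrN; apply: H; rewrite oppr_gt0.
have [c _] : exists2 c, c \in `]0, x[ & sin x - sin 0 = cos c * (x - 0).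
  apply: (@MVT R sin cos) => //.
  by apply: continuous_subspaceT => y; exact: continuous_sin.
rewrite sin0 !subr0 => ->; rewrite normrM -[leRHS]mul1r ler_wpM2r//.
by rewrite ler_norml cos_geN1 cos_le1.
Qed.

Lemma cos_half (R : realType) (x : R) : cos x = 1 - sin (x / 2) ^+ 2 *+ 2.
Proof.
rewrite -{1}[x](@divfK _ 2)// mulr_natr cos_mulr2n.
by have := cos2Dsin2 (x / 2); lra.
Qed.

(** By the mean value theorem it suffices that [cos c >= 1/2] on [[0, 1]], and
    [cos c = 1 - 2 sin(c/2)^2 >= 1 - c^2/2]. *)
Lemma sin_ge_half (R : realType) (x : R) : 0 <= x <= 1 -> x / 2 <= sin x.
Proof.
case/andP; rewrite le_eqVlt => /predU1P[<- _|x0 x1].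
  by rewrite mul0r sin0.
have [c] : exists2 c, c \in `]0, x[ & sin x - sin 0 = cos c * (x - 0).
  apply: (@MVT R sin cos) => //.
  by apply: continuous_subspaceT => y; exact: continuous_sin.
rewrite in_itv/= sin0 !subr0 => /andP[c0 cx] ->; rewrite mulrC ler_pM2r//.
rewrite (cos_half c).
have := abs_sin_le (c / 2); rewrite (@ger0_norm _ (c / 2)); last lra.
set s := sin _ => sc; have : s ^+ 2 <= (c / 2) ^+ 2.
  by rewrite -real_normK ?num_real// lerXn2r// ?nnegrE//; lra.
have : c ^+ 2 <= 1 by nra.
by rewrite expr_div_n; lra.
Qed.

(** Angle doubling extends the bound to [[0, 2]], an interval that contains [pi / 2]: in
    [2 sin(x/2) cos(x/2)] the first sine is at least [x/4] and the cosine at least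
    [1 - x^2/8 >= 1/2]. *)
Lemma sin_ge_quarter (R : realType) (x : R) : 0 <= x <= 2 -> x / 4 <= sin x.
Proof.
move=> /andP[x0 x2].
have -> : sin x = (cos (x / 2) * sin (x / 2)) *+ 2.
  by rewrite -sin_mulr2n; congr sin; rewrite mulr2n; lra.
have h : 0 <= x / 2 <= 1 by lra.
have s1 := sin_ge_half h.
have := abs_sin_le (x / 4).
rewrite (cos_half (x / 2)) (_ : x / 2 / 2 = x / 4); last by field.
rewrite (@ger0_norm _ (x / 4)); last lra.
set s := sin _ => sc; have : s ^+ 2 <= (x / 4) ^+ 2.
  by rewrite -real_normK ?num_real// lerXn2r// ?nnegrE//; lra.
have x4 : x ^+ 2 <= 4 by nra.
rewrite expr_div_n => ss; have : x / 4 <= sin (x / 2) by lra.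
move: (sin (x / 2)) => u {}s1.
have : 0 <= (1 - (s ^+ 2 + s ^+ 2) - 2^-1) * u by apply: mulr_ge0; lra.
lra.
Qed.

(** The symmetry [y -> 1 - y] reduces to [y <= 1/2], where [y pi <= 2]; the constant follows from
    [pi >= 2]. *)
Lemma sin_pi_ge (R : realType) (y : R) : 0 <= y <= 1 ->
  Num.min y (1 - y) / 2 <= sin (y * pi).
Proof.
wlog y2 : y / y <= 2^-1 => [H y01|/andP[y0 _]].
  have [|y2] := leP y 2^-1; first by move=> /H; exact.
  have -> : sin (y * pi) = sin ((1 - y) * pi).
    by rewrite mulrBl mul1r addrC sinDpi sinN opprK.
  have yE : y = 1 - (1 - y) by lra.
  by rewrite minC {2}yE; apply: H; lra.
have := pi_ge2 R; have [/andP[_ ph2] _] := pihalf_02_cos_pihalf R => pi2.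
apply: le_trans (sin_ge_quarter _); last by apply/andP; split; nra.
by rewrite min_l; nra.
Qed.

(** The shift changes sine by a sign, which squaring removes; no parity of [k] has to be tracked. *)
Lemma sin_sqr_shift (R : realType) (x : R) (k : int) :
  sin (x + k%:~R * pi) ^+ 2 = sin x ^+ 2.
Proof.
have sn : forall (n : nat) y, sin (y + n%:R * pi) ^+ 2 = sin y ^+ 2 :> R.
  elim=> [|n IH] y; first by rewrite mul0r addr0.
  by rewrite -natr1 mulrDl mul1r addrA sinDpi sqrrN.
case: k => n; first exact: sn.
by rewrite NegzE mulrNz -[LHS](sn n.+1) mulNr subrK.
Qed.

Lemma powR_ge1 (R : realType) (a t : R) : 1 <= a -> 0 <= t -> 1 <= a `^ t.
Proof. by move=> a1 t0; rewrite -(powRr0 a); exact: ler_powR. Qed.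

(** A non-natural [m + n alpha] has [n > 0] and [n alpha] not an integer, so the fractional part of
    [n alpha] stays [K B^-n] away from both 0 and 1. The resulting bound on the sine is exponential
    in [n], hence in [t], because [n alpha <= t]. *)
Lemma S_sin_lower_bound (R : realType) (alpha : R) :
  0 < alpha -> ~ in_D alpha ->
  exists2 rho : R, 1 <= rho & forall t, S_ alpha t -> 0 < t ->
    (forall k : nat, t != k%:R) -> 1 <= rho `^ t * `|sin (t * pi)|.
Proof.
move=> a0 /not_in_D_lower_bound[K [B [K0 B1 HK]]].
have B0 := lt_le_trans ltr01 B1.
(* The power [n alpha] of [M^(1/alpha)] is [M^n = L^n B^n]; since [n >= 1], a full factor [L] is
   available to absorb [2 / K]. *)
pose L := Num.max 1 (2 / K); pose M := L * B.
have L1 : 1 <= L by rewrite le_max lexx.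
have M1 : 1 <= M by rewrite mulr_ege1.
have rho1 : 1 <= M `^ alpha^-1 by rewrite powR_ge1// invr_ge0 ltW.
exists (M `^ alpha^-1) => // t [m [n ->]] t0 tnat.
have n0 : (0 < n)%N.
  rewrite lt0n; apply/negP => /eqP n0.
  by move: (tnat m); rewrite n0 mul0r addr0 eqxx.
have aint (k : int) : n%:R * alpha != k%:~R.
  apply/negP => /eqP na; have : 0 <= k%:~R :> R.
    by rewrite -na mulr_ge0// ltW.
  rewrite ler0z; case: k na => // k na _.
  by move: (tnat (m + k)%N); rewrite na natrD eqxx.
pose k := Num.floor (n%:R * alpha); pose y := n%:R * alpha - k%:~R.
have /andP[y0 y1] : 0 <= y < 1.
  by have := floor_itv (n%:R * alpha); rewrite -/k /y intrD; lra.
have Ky : K * B ^- n <= y by rewrite -(ger0_norm y0); exact: HK.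
have Ky' : K * B ^- n <= 1 - y.
  have -> : 1 - y = (k + 1)%:~R - n%:R * alpha by rewrite intrD /y; lra.
  rewrite -[leRHS]ger0_norm; last by rewrite intrD; move: y1; rewrite /y; lra.
  by rewrite distrC; exact: HK.
have -> : `|sin ((m%:R + n%:R * alpha) * pi)| = `|sin (y * pi)|.
  apply/eqP; rewrite -(eqrXn2 (n := 2))//; apply/eqP.
  rewrite !real_normK ?num_real//.
  rewrite -[RHS](sin_sqr_shift _ (m%:Z + k)); congr (sin _ ^+ 2).
  by rewrite /y intrD; ring.
have sy : K * B ^- n / 2 <= `|sin (y * pi)|.
  have y01 : 0 <= y <= 1 by rewrite y0 ltW.
  apply: le_trans (ler_norm _); apply: le_trans (sin_pi_ge y01).
  by rewrite ler_pM2r// le_min Ky.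
have Mn : L * B ^+ n <= (M `^ alpha^-1) `^ (m%:R + n%:R * alpha).
  apply: (@le_trans _ _ ((M `^ alpha^-1) `^ (n%:R * alpha))); last first.
    by apply: ler_powR => //; rewrite lerDr.
  rewrite -powRrM mulrCA mulVf ?gt_eqF// mulr1 powR_mulrn ?(le_trans ler01)//.
  rewrite /M exprMn ler_wpM2r ?exprn_ge0 ?(ltW B0)//.
  by rewrite -{1}[L]expr1; exact: ler_weXn2l.
have Bn0 : 0 < B ^+ n by rewrite exprn_gt0.
apply: (@le_trans _ _ ((L * B ^+ n) * (K * B ^- n / 2))); last first.
  by apply: ler_pM => //;
    rewrite ?mulr_ge0 ?invr_ge0 ?(ltW Bn0) ?(le_trans ler01 L1)// ltW.
have -> : L * B ^+ n * (K / B ^+ n / 2) = L * (K / 2) by field; rewrite gt_eqF.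
rewrite -ler_pdivrMr ?divr_gt0// mul1r invf_div.
by rewrite le_max lexx orbT.
Qed.

(** Every point left of [L] has a null open neighbourhood, hence lies in a null interval with
    rational endpoints, and there are countably many of these. [F] enumerates them, with the empty
    set in place of the intervals of positive mass. *)
Lemma msupport_null_left (R : realType)
    (mu : probability (measurableTypeR R) R) (L : R) :
  lbound (msupport mu) L -> mu [set` `]-oo, L[] = 0%E.
Proof.
move=> HL.
pose E (q : rat * rat) : set R := [set` `]ratr q.1, ratr q.2[].
pose F n : set (measurableTypeR R) :=
  if unpickle n is Some q then if mu (E q) == 0%E then E q else set0 else set0.
have : mu.-negligible (\bigcup_n F n).
  apply: negligible_bigcup => n; rewrite /F.
  case: (unpickle n) => [q|]; last exact: negligible_set0.
  case: ifPn => [/eqP q0|_]; last exact: negligible_set0.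
  by apply/negligibleP => //; exact: measurable_itv.
move=> /(negligibleS _)H; apply/negligibleP; first exact: measurable_itv.
apply: H => x; rewrite /= in_itv/= => xL.
have : ~ msupport mu x by move=> /HL; rewrite leNgt xL.
move=> /existsNP[U /not_implyP[oU /not_implyP[Ux /negP]]].
rewrite -leNgt measure_le0 => /eqP U0.
have /nbhs_ballP[e /= e0 eU] : nbhs x U by exact: open_nbhs_nbhs.
have xe1 : x - e < x by rewrite ltrBlDr ltrDl.
have [p] := rat_in_itvoo xe1.
rewrite in_itv/= => /andP[p1 p2].
have xe2 : x < x + e by rewrite ltrDl.
have [q] := rat_in_itvoo xe2.
rewrite in_itv/= => /andP[q1 q2].
exists (pickle (p, q)); first exact: Logic.I.
rewrite /F pickleK; suff -> : mu (E (p, q)) = 0%E.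
  by rewrite eqxx /E/= in_itv/= p2.
have mE : measurable (E (p, q) : set (measurableTypeR R)).
  exact: measurable_itv.
have mU : measurable (U : set (measurableTypeR R)) by exact: open_measurable.
apply: (subset_measure0 mE mU _ U0).
move=> z; rewrite /E/= in_itv/= => /andP[pz zq]; apply: eU.
by rewrite ball_itv/= in_itv/= (lt_trans p1)// (lt_trans zq).
Qed.

Lemma has_density_onS (R : realType) (mu : probability (measurableTypeR R) R)
    (D D' : set R) (g : R -> \bar R) :
  measurable (D' : set (measurableTypeR R)) -> D' `<=` D ->
  has_density_on mu D g -> has_density_on mu D' g.
Proof.
move=> mD' DD' H A mA; have := H (A `&` D') (measurableI _ _ mA mD').
by rewrite -setIA (setIidl DD').
Qed.

(** * Outside D *)

Lemma Im_inv_cpow (R : realType) (a : R[i]) (x s : R) :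
  complex.Im (a * inv_cpow x s) =
  if 0 <= x then complex.Im a * x `^ (- s)
  else (complex.Re a * sin (s * pi) + complex.Im a * cos (s * pi)) *
       `|x| `^ (- s).
Proof.
rewrite /inv_cpow; case: a => u v; case: ifP => _ /=.
  by rewrite mulr0 add0r.
by ring.
Qed.

Lemma vanishing_nat_coef_class_P (R : realType) (alpha c : R) :
  0 < alpha -> 0 < c -> ~ in_D alpha ->
  forall mu : probability (measurableTypeR R) R,
    class_PB (S_ alpha) c mu ->
    forall (b : R -> R) (r R0 : R),
      right_expansion (S_ alpha) c mu b r R0 ->
      (forall n : nat, (0 < n)%N -> b n%:R = 0) ->
      class_P (S_ alpha) c mu.
Proof.
move=> a0 c0 aD mu [[L /msupport_null_left muL] _] b r R0.
move=> [[r0 R00] _ br dens] bnat.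
have [rho rho1 Hrho] := S_sin_lower_bound a0 aD.
have rho0 := lt_le_trans ltr01 rho1.
pose th (t : R) := (t + 1) * pi.
(* Where the sine vanishes, division by zero makes the real part 0, and the imaginary part is 0 too
   for positive [t] in [S_ alpha], by [b0] below. *)
pose a t : R[i] := Complex (- (b t * cos (th t) / sin (th t))) (b t).
(* Beyond [R0] the given density is available, beyond [|L|] the left tail is null, and the last
   summand yields the radius inequality for [r * rho]. *)
pose R1 := R0 + `|L| + 1 + c * (r * rho).
have crr0 : 0 < c * (r * rho) by rewrite !mulr_gt0.
have Lge0 : 0 <= `|L| := normr_ge0 L.
have R10 : 0 < R1 by rewrite /R1; lra.
have sinth t : sin (th t) = - sin (t * pi).
  by rewrite /th mulrDl mul1r sinDpi.
have b0 t : S_ alpha t -> 0 < t -> sin (th t) = 0 -> b t = 0.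
  move=> St t0 sin0; have [[k tk]|] := pselect (exists k : nat, t = k%:R).
    by rewrite tk bnat// -(@ltr0n R) -tk.
  move=> /forallNP tk; have /Hrho := St.
  have nk k : t != k%:R by apply/eqP.
  move=> /(_ t0 nk); rewrite -normrN -sinth sin0 normr0 mulr0.
  by rewrite ler10.
exists a, (r * rho), R1; split.
- by rewrite mulr_gt0.
- by rewrite (mulrC c^-1) ltr_pdivlMr// mulrC /R1; lra.
- move=> t St t0; rewrite normc_def lecR /=.
  have [s0|s0] := eqVneq (sin (th t)) 0.
    by rewrite s0 invr0 mulr0 (b0 t)// oppr0 expr0n/= addr0 sqrtr0 powR_ge0.
  have -> : (- (b t * cos (th t) / sin (th t))) ^+ 2 + b t ^+ 2 =
      (b t / sin (th t)) ^+ 2.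
    transitivity
      (b t ^+ 2 * (cos (th t) ^+ 2 + sin (th t) ^+ 2) / sin (th t) ^+ 2).
      by field.
    by rewrite cos2Dsin2 mulr1 expr_div_n.
  rewrite sqrtr_sqr normrM normfV ler_pdivrMr ?normr_gt0//.
  have nk k : t != k%:R.
    apply/negP => /eqP tk; move: s0; rewrite sinth tk.
    rewrite oppr_eq0 -sqrf_eq0 -[_ * pi]add0r -[k%:R]/((k%:Z)%:~R).
    by rewrite sin_sqr_shift sin0 expr0n eqxx.
  have := Hrho t St t0 nk; rewrite -normrN -sinth => H.
  rewrite powRM ?(ltW r0) ?(ltW rho0)// -mulrA.
  apply: (le_trans (br t St t0)); rewrite -{1}[r `^ t]mulr1.
  by rewrite ler_wpM2l// powR_ge0.
pose Dp : set (measurableTypeR R) := [set` `[R1, +oo[].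
pose Dm : set (measurableTypeR R) := [set` `]-oo, - R1]].
have mDp : measurable Dp by exact: measurable_itv.
have mDm : measurable Dm by exact: measurable_itv.
have DE : [set x | R1 <= `|x|] = Dp `|` Dm.
  apply/seteqP; split => x; rewrite /Dp /Dm /= !in_itv/= andbT ler_normr.
    by case/orP=> ?; [left|right] => //; lra.
  by case=> ?; apply/orP; [left|right] => //; lra.
have Dpdens : has_density_on mu Dp
    (fun x => sum_over (S_ alpha `&` [set t | 0 < t])
                (fun t => b t * x^-1 `^ (t + 1))).
  apply: has_density_onS dens => // x.
  rewrite /Dp /= in_itv/= andbT; apply: le_trans.
  by rewrite /R1; lra.
have muDm : mu Dm = 0%E.
  apply: (subset_measure0 mDm _ _ muL); first exact: measurable_itv.
  move=> x; rewrite /Dm /= !in_itv/= => xR; apply: (le_lt_trans xR).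
  by have := ler_norm (- L); rewrite normrN /R1; lra.
move=> A mA; rewrite DE setIUr measureU0; first last.
- by apply: (subset_measure0 _ mDm _ muDm);
    [exact: measurableI|exact: subIsetr].
- exact: measurableI.
- exact: measurableI.
(* Moving both integrals to the whole line leaves a pointwise comparison: the terms agree on the
   right part and all vanish on the left part. *)
rewrite [LHS](Dpdens A mA) integral_mkcond [RHS]integral_mkcond.
apply: eq_integral => x _; rewrite !patchE in_setU !in_setI.
case: (boolP (x \in A)) => //= _.
case: (boolP (x \in Dp)) => [|_] /=.
  rewrite /Dp inE /= in_itv/= andbT => xR1.
  have x0 : 0 < x by exact: lt_le_trans xR1.
  have E t : complex.Im (a t * inv_cpow x (t + 1)) = b t * x^-1 `^ (t + 1).
    by rewrite Im_inv_cpow (ltW x0)/= -powR_inv1 ?(ltW x0)// -powRrM mulN1r.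
  by congr (_ - _)%E; apply: eq_esum => t _; rewrite ?funeposE ?funenegE /= E.
case: (boolP (x \in Dm)) => //=; rewrite /Dm inE /= in_itv/= => xR1.
have x0 : x < 0 by lra.
have E t : S_ alpha t -> 0 < t -> complex.Im (a t * inv_cpow x (t + 1)) = 0.
  move=> St t0; rewrite Im_inv_cpow leNgt x0/= -/(th t).
  have [s0|s0] := eqVneq (sin (th t)) 0; last by field.
  by rewrite (b0 t)// s0; ring.
rewrite /sum_over !esum1 ?sube0// => t [St t0];
  rewrite ?funeposE ?funenegE /= E//.
  by rewrite oppr0 [LHS]maxxx.
by rewrite [LHS]maxxx.
Qed.

(** * Series over the semigroup *)

Section sum_over_theory.
Context {R : realType}.
Implicit Types (D : set R) (f g : R -> R).

Lemma ge0_summableE D (F : R -> \bar R) : (forall t, 0 <= F t)%E ->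
  summable D F = (\esum_(t in D) F t \is a fin_num)%E.
Proof.
move=> F0; rewrite summableE; congr (_ \is a _).
by apply: eq_esum => t _; rewrite gee0_abs.
Qed.

Lemma summable_fin_num D f : summable D (EFin \o f) ->
  (\esum_(t in D) (EFin \o f)^\+ t)%E \is a fin_num /\
  (\esum_(t in D) (EFin \o f)^\- t)%E \is a fin_num.
Proof.
by move=> /[dup] /summable_funepos + /summable_funeneg; rewrite !ge0_summableE.
Qed.

Lemma sum_over_fin_num D f : summable D (EFin \o f) ->
  sum_over D f \is a fin_num.
Proof. by move=> /summable_fin_num[? ?]; rewrite fin_numB; apply/andP. Qed.

(** [sum_over] splits by sign, so subtraction does not pass through it directly. Writing [f - g] as
    the difference of the nonnegative families [f^+ + g^-] and [f^- + g^+] reduces the claim to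
    nonnegative sums. *)
Lemma sum_overB D f g :
  summable D (EFin \o f) -> summable D (EFin \o g) ->
  sum_over D (f \- g) = (sum_over D f - sum_over D g)%E.
Proof.
move=> Sf Sg.
have [fp fn] := summable_fin_num Sf; have [gp gn] := summable_fin_num Sg.
pose F t := ((EFin \o f)^\+ t + (EFin \o g)^\- t)%E.
pose G t := ((EFin \o f)^\- t + (EFin \o g)^\+ t)%E.
have F0 t : (0 <= F t)%E by rewrite adde_ge0.
have G0 t : (0 <= G t)%E by rewrite adde_ge0.
have sF : summable D F by rewrite ge0_summableE// esumD// fin_numD fp.
have sG : summable D G by rewrite ge0_summableE// esumD// fin_numD fn.
have FGE : EFin \o (f \- g) = (F \- G)%E.
  apply/funext => t; rewrite /F /G !funeposE !funenegE /=.
  rewrite -!EFin_max -!EFinD; congr EFin.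
  rewrite /Num.max; case: (ltP (f t)) => ?; case: (ltP (- g t)) => ?;
    by case: (ltP (- f t)) => ?; case: (ltP (g t)) => ?; lra.
rewrite {1}/sum_over FGE esumB// !esumD// /sum_over.
move: fp fn gp gn.
case: (\esum_(t in D) _)%E => // a _; case: (\esum_(t in D) _)%E => // b _.
case: (\esum_(t in D) _)%E => // c _; case: (\esum_(t in D) _)%E => // d _.
by rewrite /=; congr EFin; lra.
Qed.

End sum_over_theory.

Lemma esum_geometric (R : realType) (a z : R) : 0 <= a -> 0 <= z < 1 ->
  (\esum_(n in [set: nat]) (a * z ^+ n)%:E = (a / (1 - z))%:E)%E.
Proof.
move=> a0 /andP[z0 z1].
rewrite -nneseries_esumT; last first.
  by move=> n; rewrite lee_fin mulr_ge0// exprn_ge0.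
apply/cvg_lim => //.
under eq_fun do rewrite sumEFin.
apply: cvg_EFin; first exact: nearW.
by apply: cvg_geometric_series; rewrite ger0_norm.
Qed.

Section semigroup.
Context {R : realType}.
Variable alpha : R.
Hypothesis alpha_gt0 : 0 < alpha.

Lemma S_finite_le (T : R) : finite_set (S_ alpha `&` [set t | t <= T]).
Proof.
pose N := Num.bound T; pose N' := Num.bound (T / alpha).
apply: (@sub_finite_set _ _
  ((fun k : nat * nat => k.1%:R + k.2%:R * alpha) @` (`I_N `*` `I_N'))).
  move=> t [[m [n ->]] /= mnT].
  have na0 : 0 <= n%:R * alpha by rewrite mulr_ge0// ltW.
  have m0 : 0 <= m%:R :> R by [].
  have T0 : 0 <= T by lra.
  exists (m, n) => //; split => /=; rewrite -(ltr_nat R).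
    by apply: le_lt_trans (archi_boundP T0); lra.
  apply: (@le_lt_trans _ _ (T / alpha)); first by rewrite ler_pdivlMr//; lra.
  by apply: archi_boundP; rewrite divr_ge0// ltW.
by apply: finite_image; exact: finite_setX.
Qed.

(** This makes infima of nonempty subsets of the semigroup attained, and keeps all later exponents a
    fixed distance away from the leading one. *)
Lemma S_gap (t : R) :
  exists2 e : R, 0 < e & forall s, S_ alpha s -> t < s -> t + e <= s.
Proof.
have [e e0 He] := finite_gap t (S_finite_le (t + 1)).
exists (Num.min e 1); first by rewrite lt_min e0/=.
move=> s Ss ts; have [st|/ltW st] := leP s (t + 1).
  apply: le_trans (He s _ ts) => //.
  by rewrite lerD2l ge_min lexx.
by apply: le_trans st; rewrite lerD2l ge_min lexx orbT.
Qed.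

Hypothesis alpha_irr : irrational alpha.

(** Two representations of one element would make a positive multiple of [alpha] an integer. Sums
    over [S_ alpha] thereby become double sums over pairs. *)
Lemma S_inj : injective (fun k : nat * nat => k.1%:R + k.2%:R * alpha).
Proof.
have H (m n m' n' : nat) : m%:R + n%:R * alpha = m'%:R + n'%:R * alpha ->
    (n' <= n)%N -> n = n'.
  move=> e n'n; apply/eqP; rewrite eqn_leq n'n andbT leqNgt; apply/negP => nn'.
  have := @irrational_mul_neq_int _ alpha (m'%:Z - m%:Z) (n - n')%N alpha_irr.
  rewrite subn_gt0 nn' => /(_ isT)/negP; apply; apply/eqP.
  by rewrite natrB// intrB mulrBl; lra.
move=> [m n] [m' n'] /= e; have nn' : n = n'.
  case/orP: (leq_total n' n) => nn; first exact: (H _ _ _ _ e).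
  by apply/esym; exact: (H _ _ _ _ (esym e)).
by move: e; rewrite nn' => /addIr/eqP; rewrite eqr_nat => /eqP ->.
Qed.

(** The double sum factors into two geometric series, of ratios [q] and [q^alpha]. *)
Lemma esum_S_powR (C q : R) : 0 <= C -> 0 < q < 1 ->
  (\esum_(t in S_ alpha) (C * q `^ t)%:E =
   (C / (1 - q `^ alpha) / (1 - q))%:E)%E.
Proof.
move=> C0 /andP[q0 q1].
have qa : 0 <= q `^ alpha < 1.
  rewrite powR_ge0/=; have := gt0_ltr_powR alpha_gt0 _ _ q1.
  by rewrite powR1; apply; rewrite nnegrE// ltW.
have SE : S_ alpha = (fun k : nat * nat => k.1%:R + k.2%:R * alpha) @` setT.
  apply/seteqP; split => t /=; first by move=> [m [n ->]]; exists (m, n).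
  by move=> [[m n] _ <-]; exists m, n.
rewrite SE esum_image; last by move=> x y _ _; exact: S_inj.
have -> : [set: nat * nat] = [set: nat] `*`` (fun=> [set: nat]).
  by apply/seteqP; split.
rewrite -(@esum_esum _ _ _ _ _
  (fun m n : nat => (C * q `^ (m%:R + n%:R * alpha))%:E)); last first.
  by move=> m n _ _; rewrite lee_fin mulr_ge0// powR_ge0.
rewrite -[RHS]esum_geometric ?q1 ?(ltW q0)//; last first.
  by rewrite divr_ge0// subr_ge0; case/andP: qa => _ /ltW.
apply: eq_esum => m _.
rewrite mulrAC -esum_geometric//; last by rewrite mulr_ge0// exprn_ge0// ltW.
apply: eq_esum => n _; congr EFin.
rewrite powRD ?(gt_eqF q0) ?implybT// -mulrA mulrC [n%:R * _]mulrC powRrM.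
by rewrite !powR_mulrn ?powR_ge0// ?(ltW q0)// mulrC mulrA.
Qed.

End semigroup.

(** * Leading terms of expansions *)

Section leading_term.
Context {R : realType}.
Variable alpha : R.
Hypotheses (alpha_gt0 : 0 < alpha) (alpha_irr : irrational alpha).
Let D := S_ alpha `&` [set t | 0 < t].

Lemma esum_subset (A B : set R) (f : R -> \bar R) : A `<=` B ->
  (\esum_(t in A) f t <= \esum_(t in B) f t)%E.
Proof.
move=> AB; apply: le_ereal_sup => _ [X [fX XA] <-].
by exists X => //; split=> //; exact: subset_trans AB.
Qed.

Lemma powR_ratio (x rho t : R) : 0 < x -> 0 < rho ->
  rho `^ t * x `^ (- (t + 1)) = x^-1 * (rho / x) `^ t.
Proof.
move=> x0 rho0; rewrite opprD powRD ?(gt_eqF x0) ?implybT// powR_inv1 ?ltW//.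
rewrite powRM ?invr_ge0 ?ltW// mulrA mulrC; congr (_ * (_ * _)).
by rewrite -[in RHS]powR_inv1 ?ltW// -powRrM mulN1r.
Qed.

Lemma powR_series_summable (d : R -> R) (C rho x : R) :
  0 <= C -> 0 < rho -> rho < x -> (forall t, D t -> `|d t| <= C * rho `^ t) ->
  summable D (EFin \o (fun t => d t * x `^ (- (t + 1)))).
Proof.
move=> C0 rho0 rhox Hd; have x0 := lt_trans rho0 rhox.
have q01 : 0 < rho / x < 1 by rewrite divr_gt0//= ltr_pdivrMr ?mul1r.
have Cx0 : 0 <= C * x^-1 by rewrite mulr_ge0// invr_ge0 ltW.
apply: (@le_lt_trans _ _ (\esum_(t in D) ((C * x^-1) * (rho / x) `^ t)%:E)).
  apply: le_esum => t Dt /=; rewrite lee_fin normrM (ger0_norm (powR_ge0 _ _)).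
  rewrite -mulrA -powR_ratio// mulrA ler_wpM2r ?powR_ge0//; exact: Hd.
apply: (le_lt_trans (esum_subset _ (@subIsetl _ _ _))).
by rewrite esum_S_powR// ltry.
Qed.

(** The positive part contains the term at [t0]. The negative part only involves exponents beyond
    [t0], hence at least [t0 + e], so it is [O(x^(-(t0+1)-e))] and eventually below half of that
    term. *)
Lemma leading_term_lower_bound (d : R -> R) (C rho t0 : R) :
  0 <= C -> 0 < rho -> (forall t, D t -> `|d t| <= C * rho `^ t) ->
  D t0 -> (forall t, D t -> t < t0 -> d t = 0) -> 0 < d t0 ->
  exists2 X : R, 0 < X & forall x, X <= x ->
    ((d t0 / 2 * x `^ (- (t0 + 1)))%:E <=
     sum_over D (fun t => (d t * x `^ (- (t + 1)))%R))%E.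
Proof.
move=> C0 rho0 Hd Dt0 Hlt dt0.
have [e e0 He] := S_gap alpha_gt0 t0.
(* Doubling the radius writes [rho^t] as [2^-t Y^t]: the factor [2^-t] keeps the sum over the
   semigroup finite once the powers of [Y] are compared with those of [x]. *)
pose Y := 2 * rho; have Y0 : 0 < Y by rewrite mulr_gt0.
pose q : R := 2^-1; have q01 : 0 < q < 1 by rewrite /q; lra.
pose K := C * Y `^ (t0 + e) / (1 - q `^ alpha) / (1 - q).
have CY0 : 0 <= C * Y `^ (t0 + e) by rewrite mulr_ge0// powR_ge0.
(* The second summand forces [x^e] above [2 |K| / d t0], that is, [|K| x^-e] below [d t0 / 2]. *)
pose X := Y + (2 * `|K| / d t0 + 1) `^ e^-1.
have X0 : 0 < X by rewrite ltr_wpDr// powR_ge0.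
exists X => // x Xx.
have x0 : 0 < x := lt_le_trans X0 Xx.
have Yx : Y <= x by apply: le_trans Xx; rewrite lerDl powR_ge0.
have rhox : rho < x by apply: lt_le_trans Yx; rewrite /Y; lra.
pose f t := d t * x `^ (- (t + 1)).
have [fp fn] := summable_fin_num (powR_series_summable C0 rho0 rhox Hd).
have lb : ((d t0 * x `^ (- (t0 + 1)))%:E <= \esum_(t in D) (EFin \o f)^\+ t)%E.
  apply: esum_ge; exists [set t0]; first by split=> // t ->.
  by rewrite fsbig_set1 funeposE le_max lexx.
have Kx : `|K| * x `^ (- e) <= d t0 / 2.
  rewrite powRN ler_pdivrMr ?powR_gt0//.
  have : 2 * `|K| / d t0 + 1 <= x `^ e.
    have -> : 2 * `|K| / d t0 + 1 = ((2 * `|K| / d t0 + 1) `^ e^-1) `^ e.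
      rewrite -powRrM mulVf ?gt_eqF// powRr1// addr_ge0//.
      by rewrite divr_ge0 ?mulr_ge0// ltW.
    rewrite ge0_ler_powR ?nnegrE ?powR_ge0 ?(ltW x0) ?(ltW e0)//.
    by apply: le_trans Xx; rewrite lerDr ltW.
  move=> H; have : 2 * `|K| / d t0 <= x `^ e by lra.
  by rewrite ler_pdivrMr//; lra.
have ub : (\esum_(t in D) (EFin \o f)^\- t <=
    (d t0 / 2 * x `^ (- (t0 + 1)))%:E)%E.
  pose B := C * Y `^ (t0 + e) * x `^ (- (t0 + 1)) * x `^ (- e).
  have B0 : 0 <= B by rewrite /B !mulr_ge0 ?powR_ge0.
  apply: (@le_trans _ _ (\esum_(t in D) (B * q `^ t)%:E)).
    apply: le_esum => t Dt; rewrite funenegE /= -EFin_max lee_fin ge_max.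
    rewrite mulr_ge0 ?powR_ge0// andbT.
    have [tt0|tt0|->] := ltgtP t t0.
    - by rewrite /f Hlt// mul0r oppr0 mulr_ge0 ?powR_ge0.
    - apply: (le_trans (ler_norm _)).
      rewrite normrN normrM (ger0_norm (powR_ge0 _ _)).
      have tet := He t Dt.1 tt0.
      apply: (@le_trans _ _ (C * rho `^ t * x `^ (- (t + 1)))).
        by rewrite ler_wpM2r ?powR_ge0//; exact: Hd.
      have -> : rho `^ t = q `^ t * Y `^ t.
        rewrite -powRM ?(ltW Y0)// /q ?invr_ge0//.
        by rewrite /Y mulrA mulVf// mul1r.
      (* Beyond the exponent [t0 + e], the power of [Y] is dominated by the same power of [x], since
         [Y <= x]; what remains is [B * q^t]. *)
      have -> : Y `^ t = Y `^ (t0 + e) * Y `^ (t - t0 - e).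
        by rewrite -powRD ?(gt_eqF Y0) ?implybT//; congr (_ `^ _); lra.
      have -> : x `^ (- (t + 1)) =
          x `^ (- (t0 + 1)) * x `^ (- e) * x `^ (- (t - t0 - e)).
        by rewrite -!powRD ?(gt_eqF x0) ?implybT//; congr (_ `^ _); lra.
      have -> : C * (q `^ t * (Y `^ (t0 + e) * Y `^ (t - t0 - e))) *
          (x `^ (- (t0 + 1)) * x `^ (- e) * x `^ (- (t - t0 - e))) =
          B * q `^ t * (Y `^ (t - t0 - e) * x `^ (- (t - t0 - e))).
        by rewrite /B; ring.
      rewrite -[leRHS]mulr1 ler_wpM2l ?mulr_ge0 ?powR_ge0//.
      rewrite powRN ler_pdivrMr ?powR_gt0// mul1r.
      by rewrite ge0_ler_powR ?nnegrE ?(ltW x0) ?(ltW Y0)//; lra.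
    - apply: (@le_trans _ _ 0); last by rewrite mulr_ge0 ?powR_ge0.
      by rewrite oppr_le0 mulr_ge0 ?powR_ge0 ?(ltW dt0).
  apply: (le_trans (esum_subset _ (@subIsetl _ _ _))).
  rewrite esum_S_powR// lee_fin.
  have -> : B / (1 - q `^ alpha) / (1 - q) = K * x `^ (- e) * x `^ (- (t0 + 1)).
    by rewrite /B /K; ring.
  rewrite ler_wpM2r ?powR_ge0//; apply: le_trans Kx.
  by rewrite ler_wpM2r ?powR_ge0// ler_norm.
rewrite /sum_over leeBrDr//; apply: le_trans lb.
apply: (le_trans (leeD2l _ ub)).
by rewrite -EFinD lee_fin -mulrDl -splitr.
Qed.

(** The difference of the two series is governed by the smallest exponent where the coefficients
    differ; its sign there decides which alternative holds. *)
Lemma expansion_separation (d1 d2 : R -> R) (rho : R) : 0 < rho ->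
  (forall t, D t -> `|d1 t| <= rho `^ t) ->
  (forall t, D t -> `|d2 t| <= rho `^ t) ->
  (exists2 t, D t & d1 t != d2 t) ->
  exists X0 : R, forall X, X0 <= X -> exists2 delta : R, 0 < delta &
    (forall x, X <= x <= X + 1 ->
      (sum_over D (fun t => (d2 t * x `^ (- (t + 1)))%R) + delta%:E <=
       sum_over D (fun t => (d1 t * x `^ (- (t + 1)))%R))%E) \/
    (forall x, X <= x <= X + 1 ->
      (sum_over D (fun t => (d1 t * x `^ (- (t + 1)))%R) + delta%:E <=
       sum_over D (fun t => (d2 t * x `^ (- (t + 1)))%R))%E).
Proof.
move=> rho0 H1 H2 ex12.
have [t0 [Dt0 dt0 t0min]] : exists t0, [/\ D t0, d1 t0 != d2 t0 &
    forall t, D t -> t < t0 -> d1 t = d2 t].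
  pose E := [set t | D t /\ d1 t != d2 t].
  have E0 : E !=set0 by case: ex12 => t1 ? ?; exists t1.
  have Elb : has_lbound E by exists 0 => t [[_ /= /ltW]].
  (* If the infimum were not attained, the gap after it would yield a larger lower bound. *)
  have iE : E (inf E).
    apply: contrapT => iE; have [e e0 He] := S_gap alpha_gt0 (inf E).
    have : inf E + e <= inf E.
      apply: lb_le_inf => // t Et; apply: He; first by case: Et => -[].
      rewrite lt_neqAle (ge_inf Elb Et) andbT; apply/eqP => it.
      by apply: iE; rewrite it.
    by rewrite gerDl leNgt e0.
  exists (inf E); split; [exact: iE.1|exact: iE.2|].
  move=> t Dt tE; apply/eqP; apply: contraTT tE => dt.
  by rewrite -leNgt; apply: ge_inf.
clear ex12; wlog dlt : d1 d2 H1 H2 dt0 t0min / d2 t0 < d1 t0.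
  move=> W; have [lt12|lt21|dE] := ltgtP (d1 t0) (d2 t0).
  - have [||X0 HX] := W d2 d1 H2 H1 _ _ lt12; first by rewrite eq_sym.
      by move=> t Dt tt0; rewrite t0min.
    exists X0 => X XX; have [de de0 [?|?]] := HX X XX; exists de => //.
      by right.
    by left.
  - exact: W.
  - by move: dt0; rewrite dE eqxx.
pose d t := d1 t - d2 t.
have dgt0 : 0 < d t0 by rewrite subr_gt0.
have dbd t : D t -> `|d t| <= 2 * rho `^ t.
  move=> Dt; apply: (le_trans (ler_normB _ _)).
  by have := H1 t Dt; have := H2 t Dt; lra.
have dlow t : D t -> t < t0 -> d t = 0.
  by move=> Dt tt0; rewrite /d t0min// subrr.
have [X1 X10 HX] := leading_term_lower_bound (ler0n _ 2) rho0 dbd Dt0 dlow dgt0.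
(* The power [x^(-(t0+1))] decreases, so its value at [X + 1] serves the whole interval. Staying
   beyond [rho] keeps both series summable, so that they can be subtracted. *)
exists (X1 + rho + 1) => X XX; exists (d t0 / 2 * (X + 1) `^ (- (t0 + 1))).
  by rewrite mulr_gt0 ?divr_gt0 ?powR_gt0//; lra.
left => x /andP[Xx xX].
have x0 : 0 < x by lra.
have s1 : summable D (EFin \o (fun t => d1 t * x `^ (- (t + 1)))).
  apply: (@powR_series_summable _ 1 rho) => //; first lra.
  by move=> t Dt; rewrite mul1r H1.
have s2 : summable D (EFin \o (fun t => d2 t * x `^ (- (t + 1)))).
  apply: (@powR_series_summable _ 1 rho) => //; first lra.
  by move=> t Dt; rewrite mul1r H2.
rewrite addeC -leeBrDr ?sum_over_fin_num// -sum_overB//.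
have -> : (fun t => d1 t * x `^ (- (t + 1))) \-
    (fun t => d2 t * x `^ (- (t + 1))) =
    (fun t => d t * x `^ (- (t + 1))).
  by apply/funext => t /=; rewrite mulrBl.
apply: le_trans (HX x _); last lra.
rewrite lee_fin ler_wpM2l ?divr_ge0 ?(ltW dgt0)//.
rewrite !powRN lef_pV2 ?posrE ?powR_gt0//; last lra.
rewrite ge0_ler_powR ?nnegrE//; try lra.
by have := Dt0.2 => /=; lra.
Qed.

End leading_term.

(** * Integrals and densities *)

Section integral_comparison.
Local Open Scope ereal_scope.
Context d (T : measurableType d) (R : realType).
Variable mu : {measure set T -> \bar R}.

(** The integral is built from suprema over simple functions, so it is monotone on arbitrary
    functions. This lets a series with unknown coefficients be compared without proving it
    measurable. *)
Lemma le_integral_pointwise (A : set T) (f g : T -> \bar R) :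
  (forall x, A x -> f x <= g x) ->
  \int[mu]_(x in A) f x <= \int[mu]_(x in A) g x.
Proof.
move=> fg; have fgA x : (f \_ A) x <= (g \_ A) x.
  by rewrite !patchE; case: ifPn => //; rewrite inE => /fg.
apply: leeB; apply: le_ereal_sup => _ [h /= hle <-]; exists h => // x;
    apply: (le_trans (hle x)).
  by rewrite !funeposE ge_max !le_max lexx fgA/= orbT.
by rewrite !funenegE ge_max !le_max lexx leeN2 fgA/= orbT.
Qed.

Variables (A : set T) (h : T -> \bar R) (delta : R).
Hypotheses (mA : measurable A) (A_gt0 : 0 < mu A) (A_fin : mu A < +oo).
Hypotheses (delta_gt0 : (0 < delta)%R) (inth : mu.-integrable A h).

Let integrable_delta : mu.-integrable A (cst delta%:E).
Proof.
apply/integrableP; split; first exact: measurable_cst.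
by rewrite integral_cst//= lte_mul_pinfty.
Qed.

Lemma lt_integral_above (g : T -> \bar R) :
  (forall x, A x -> h x + delta%:E <= g x) ->
  \int[mu]_(x in A) h x < \int[mu]_(x in A) g x.
Proof.
move=> hg; apply: lt_le_trans (le_integral_pointwise hg).
rewrite integralD//.
rewrite integral_cst// lteDl ?integrable_fin_num//.
by rewrite mule_gt0.
Qed.

Lemma lt_integral_below (g : T -> \bar R) :
  (forall x, A x -> g x + delta%:E <= h x) ->
  \int[mu]_(x in A) g x < \int[mu]_(x in A) h x.
Proof.
move=> hg; have hg' x : A x -> g x <= h x - delta%:E.
  by move=> Ax; rewrite leeBrDr// hg.
apply: le_lt_trans (le_integral_pointwise hg') _.
rewrite integralB//.
rewrite integral_cst// lteBlDr; last first.
  by rewrite fin_numM// ge0_fin_numE.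
rewrite lteDl ?integrable_fin_num//.
by rewrite mule_gt0.
Qed.

End integral_comparison.

Lemma probability_of_density (R : realType) (f : R -> R) :
  measurable_fun setT f -> (forall x, 0 <= f x) ->
  (\int[@lebesgue_measure R]_x (f x)%:E = 1)%E ->
  exists mu : probability (measurableTypeR R) R,
    forall A, measurable A ->
      (mu A = \int[@lebesgue_measure R]_(x in A) (f x)%:E)%E.
Proof.
move=> mf f0 f1.
pose nu (A : set (measurableTypeR R)) :=
  (\int[@lebesgue_measure R]_(x in A) (f x)%:E)%E.
have nu0 : nu set0 = 0%E by rewrite /nu integral_set0.
have nu_ge0 A : (0 <= nu A)%E by apply: integral_ge0 => x _; rewrite lee_fin.
have nu_sigma : semi_sigma_additive nu.
  by apply: semi_sigma_additive_nng_induced => //; exact/measurable_EFinP.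
pose mM := isMeasure.Build _ _ _ nu nu0 nu_ge0 nu_sigma.
pose M := HB.pack_for (measure (measurableTypeR R) R) nu mM.
pose mP := Measure_isProbability.Build _ _ _ M f1.
pose P := HB.pack_for (probability (measurableTypeR R) R) nu M mP.
by exists P.
Qed.

(** * A probability measure with a geometric density *)

Section pareto.
Context {R : realType}.
Local Notation leb := (@lebesgue_measure R).

(** The antiderivative [-x^(-a)] tends to 0 at infinity. *)
Lemma integral_powR_tail (a x0 : R) : 0 < a -> 0 < x0 ->
  (\int[leb]_(x in [set` `[x0, +oo[]) (a * x `^ (- (a + 1)))%:E =
   (x0 `^ (- a))%:E)%E.
Proof.
move=> a0 x00.
have pos x : x \in `[x0, +oo[%classic -> 0 < x.
  by rewrite inE/= in_itv/= andbT; exact: lt_le_trans.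
have dF (x : R) : 0 < x ->
    is_derive x 1 (fun x : R => - (x `^ (- a))) (a * x `^ (- (a + 1))).
  move=> xp; rewrite -[a * _]opprK -mulNr opprD.
  have H := is_derive1_powR (- a) xp.
  exact: (is_deriveN H).
rewrite (@ge0_continuous_FTC2y _ _ (fun x : R => - (x `^ (- a))) _ 0).
- by rewrite sub0e -EFinN opprK.
- by move=> x _; rewrite mulr_ge0 ?powR_ge0 ?ltW.
- apply: continuous_in_subspaceT => x /pos xp.
  apply: differentiable_continuous; apply/derivable1_diffP.
  apply: derivableM; first exact: derivable_cst.
  by apply: derivable_powR; rewrite in_itv/= andbT.
- rewrite -oppr0; apply: cvgN; apply/cvgrPdist_le => e e0.
  (* This threshold solves [x^(-a) = e]. *)
  near=> x; have xe : (e^-1) `^ a^-1 <= x by near: x; exact: nbhs_pinfty_ge.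
  have xp : 0 < x by apply: lt_le_trans xe; rewrite powR_gt0 ?invr_gt0.
  rewrite sub0r normrN ger0_norm ?powR_ge0// powRN invf_ple ?posrE ?powR_gt0//.
  have -> : e^-1 = ((e^-1) `^ a^-1) `^ a.
    by rewrite -powRrM mulVf ?gt_eqF// powRr1// invr_ge0 ltW.
  by rewrite ge0_ler_powR ?nnegrE ?powR_ge0 ?(ltW a0) ?(ltW xp).
- by move=> x x0x; have [] := dF x (lt_trans x00 x0x).
- have c : {for x0, continuous (fun x : R => - (x `^ (- a)))}.
    apply: differentiable_continuous; apply/derivable1_diffP.
    by have [] := dF x0 x00.
  exact: cvg_at_right_filter.
- move=> x; rewrite in_itv/= andbT => x0x.
  by rewrite derive1E; have [] := dF x (lt_trans x00 x0x).
Unshelve. all: by end_near. Qed.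

Variable alpha : R.
Hypothesis alpha_gt0 : 0 < alpha.

Definition multiples_pos : set R := range (fun n : nat => n.+1%:R * alpha).

(** The sum of [x^(-n alpha - 1)] over [n >= 1], for [x > 1]. Writing the reciprocal with [powR]
    makes the function nonnegative and measurable on the whole line. *)
Definition geom_density (x : R) : R :=
  x `^ (- (alpha + 1)) * (1 - x `^ (- alpha)) `^ (-1).

Lemma geom_density_ge0 x : 0 <= geom_density x.
Proof. by rewrite mulr_ge0 ?powR_ge0. Qed.

Lemma measurable_geom_density : measurable_fun setT geom_density.
Proof.
apply: measurable_funM; first exact: measurable_powR.
apply: (measurableT_comp (measurable_powR (-1))).
by apply: measurable_funB => //; exact: measurable_powR.
Qed.

Lemma geom_density_series (x : R) : 1 < x ->
  sum_over (S_ alpha `&` [set t | 0 < t])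
    (fun t => \1_multiples_pos t * x `^ (- (t + 1))) = (geom_density x)%:E.
Proof.
move=> x1; have x0 : 0 < x by rewrite (lt_trans ltr01).
set D := S_ alpha `&` _.
have DE : D `&` multiples_pos = multiples_pos.
  apply/setIidPr => _ [n _ <-]; split; last by rewrite /= mulr_gt0.
  by exists 0%N, n.+1; rewrite add0r.
have f0 t : 0 <= \1_multiples_pos t * x `^ (- (t + 1)).
  by rewrite mulr_ge0 ?powR_ge0// indicE.
rewrite /sum_over [X in (_ - X)%E]esum1 ?sube0; last first.
  by move=> t _; rewrite funenegE /= -EFin_max max_r// oppr_le0.
rewrite (eq_esum (b := fun t => if t \in multiples_pos then
    (x `^ (- (t + 1)))%:E else 0%E)); last first.
  move=> t _; rewrite funeposE /= -EFin_max max_l// indicE.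
  by case: ifP => _; rewrite ?mul1r ?mul0r.
rewrite -esum_mkcondr DE esum_image; last first.
  move=> m n _ _ /(mulIf (lt0r_neq0 alpha_gt0))/eqP.
  by rewrite eqr_nat => /eqP[].
have z01 : 0 <= x `^ (- alpha) < 1.
  rewrite powR_ge0/= powRN invf_lt1 ?powR_gt0//.
  have := gt0_ltr_powR alpha_gt0 _ _ x1.
  by rewrite powR1; apply; rewrite nnegrE// ltW.
rewrite /geom_density powR_inv1; last first.
  by case/andP: z01 => _ /ltW; rewrite subr_ge0.
rewrite -(esum_geometric (powR_ge0 _ _) z01); apply: eq_esum => n _; congr EFin.
rewrite -powR_mulrn ?powR_ge0// -powRrM -powRD ?(gt_eqF x0) ?implybT//.
by congr (_ `^ _); rewrite -natr1; ring.
Qed.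

(** Since [x^alpha >= 2], the denominator [1 - x^(-alpha)] is at least 1/2, so the density is at
    most [2 / alpha] times a Pareto density. The tail is then at most
    [(2 / alpha) x0^(-alpha) <= 1]. *)
Lemma geom_density_tail (x0 : R) : 1 <= x0 -> 2 + 2 / alpha <= x0 `^ alpha ->
  (\int[leb]_(x in [set` `[x0, +oo[]) (geom_density x)%:E <= 1)%E.
Proof.
move=> x01 Hx0; have x0p := lt_le_trans ltr01 x01.
apply: (@le_trans _ _ (\int[leb]_(x in [set` `[x0, +oo[])
   ((2 / alpha)%:E * (alpha * x `^ (- (alpha + 1)))%:E))%E).
  apply: le_integral_pointwise => x; rewrite /= in_itv/= andbT => x0x.
  have xp := lt_le_trans x0p x0x.
  have xa : x0 `^ alpha <= x `^ alpha.
    by rewrite ge0_ler_powR ?nnegrE ?(ltW alpha_gt0) ?(ltW xp) ?(ltW x0p).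
  have a2 : 0 <= 2 / alpha by rewrite divr_ge0// ltW.
  have half : x `^ (- alpha) <= 2^-1.
    by rewrite powRN lef_pV2 ?posrE ?powR_gt0//; lra.
  rewrite -EFinM lee_fin mulrA divfK ?gt_eqF// /geom_density mulrC.
  rewrite ler_wpM2r ?powR_ge0// powR_inv1; last lra.
  by rewrite -[leRHS]invrK lef_pV2 ?posrE; lra.
have mp : measurable_fun (`[x0, +oo[%classic : set R)
    (fun x => (alpha * x `^ (- (alpha + 1)))%:E).
  apply/measurable_EFinP; apply: measurable_funTS; apply: measurable_funM.
    exact: measurable_cst.
  exact: measurable_powR.
have a2 : 0 <= 2 / alpha by rewrite divr_ge0// ltW.
have p0 x : `[x0, +oo[%classic x -> (0 <= (alpha * x `^ (- (alpha + 1)))%:E)%E.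
  by rewrite lee_fin mulr_ge0 ?powR_ge0 ?ltW.
rewrite ge0_integralZl_EFin//.
rewrite integral_powR_tail// -EFinM lee_fin powRN ler_pdivrMr ?powR_gt0// mul1r.
by lra.
Qed.

Lemma geom_probability (x0 : R) : 1 < x0 -> 2 + 2 / alpha <= x0 `^ alpha ->
  exists mu : probability (measurableTypeR R) R,
    mu [set` `]-oo, 0[] = 0%E /\
    has_density_on mu [set x | x0 <= x] (EFin \o geom_density).
Proof.
move=> x01 Hx0; have x01' := ltW x01.
have tail := geom_density_tail x01' Hx0.
pose m := fine (\int[leb]_(x in [set` `[x0, +oo[]) (geom_density x)%:E)%E.
have tail0 : (0 <= \int[leb]_(x in [set` `[x0, +oo[]) (geom_density x)%:E)%E.
  by apply: integral_ge0 => x _; rewrite lee_fin geom_density_ge0.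
have mE : (\int[leb]_(x in [set` `[x0, +oo[]) (geom_density x)%:E)%E = m%:E.
  by rewrite /m fineK// ge0_fin_numE// (le_lt_trans tail)// ltry.
have m1 : 0 <= 1 - m by rewrite subr_ge0 -lee_fin -mE.
pose I : set R := [set` `[x0, +oo[]; pose J : set R := [set` `[0, 1]].
(* The missing mass goes to [[0, 1]], which is disjoint from the tail because [x0 > 1] and leaves
   the negative half-line null. *)
pose f x := geom_density x * \1_I x + (1 - m) * \1_J x.
have f0 x : 0 <= f x.
  by rewrite addr_ge0// mulr_ge0 ?geom_density_ge0// indicE.
have mf1 : measurable_fun setT (fun x => geom_density x * \1_I x).
  apply: measurable_funM; first exact: measurable_geom_density.
  by apply: measurable_indic; exact: measurable_itv.
have mf2 : measurable_fun setT (fun x => (1 - m) * \1_J x).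
  apply: measurable_funM => //.
  by apply: measurable_indic; exact: measurable_itv.
have mf : measurable_fun setT f by exact: measurable_funD.
have f1 : (\int[leb]_x (f x)%:E = 1)%E.
  rewrite /f; under eq_integral do rewrite EFinD.
  rewrite ge0_integralD//; first last.
  - exact/measurable_EFinP.
  - by move=> x _; rewrite lee_fin mulr_ge0// indicE.
  - exact/measurable_EFinP.
  - by move=> x _; rewrite lee_fin mulr_ge0 ?geom_density_ge0// indicE.
  have -> : (\int[leb]_x (geom_density x * \1_I x)%:E = m%:E)%E.
    rewrite -mE [RHS]integral_mkcond; apply: eq_integral => x _.
    by rewrite patchE indicE; case: ifP => _; rewrite ?mulr1 ?mulr0.
  have -> : (\int[leb]_x ((1 - m) * \1_J x)%:E = (1 - m)%:E)%E.
    transitivity (\int[leb]_(x in J) (1 - m)%:E)%E.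
      rewrite [RHS]integral_mkcond; apply: eq_integral => x _.
      by rewrite patchE indicE; case: ifP => _; rewrite ?mulr1 ?mulr0.
    rewrite integral_cst; last exact: measurable_itv.
    have J1 : leb J = 1%E.
      by rewrite lebesgue_measure_itv/= lte_fin ltr01 oppr0 adde0.
    by rewrite -[RHS]mule1; congr (_ * _)%E; exact: J1.
  by rewrite -EFinD addrC subrK.
have [mu muE] := probability_of_density mf f0 f1.
exists mu; split.
  rewrite muE; last exact: measurable_itv.
  apply: integral0_eq => x; rewrite /= in_itv/= => x0'.
  rewrite /f !indicE !memNset ?mulr0 ?addr0//.
    by rewrite /J/= in_itv/= leNgt x0'.
  by rewrite /I/= in_itv/= andbT leNgt (lt_trans x0')//; lra.
move=> A mA; have IE : [set x | x0 <= x] = I.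
  by apply/seteqP; split => x; rewrite /I/= in_itv/= andbT.
rewrite IE muE; last by apply: measurableI => //; exact: measurable_itv.
apply: eq_integral => x; rewrite inE => -[_ Ix].
rewrite /f !indicE mem_set// memNset ?mulr0 ?addr0 ?mulr1//.
move: Ix; rewrite /I /J/= !in_itv/= andbT => x0x /andP[_ x1].
by have := le_lt_trans x1 x01; rewrite ltNge x0x.
Qed.

End pareto.

(** * Uniqueness of expansions *)

Section uniqueness.
Context {R : realType}.
Variable alpha : R.
Hypotheses (alpha_gt0 : 0 < alpha) (alpha_irr : irrational alpha).
Let D := S_ alpha `&` [set t | 0 < t].
Local Notation leb := (@lebesgue_measure R).

(* [s = -1] handles the expansion on the negative half-line. *)
Lemma expansion_unique (d1 d2 h : R -> R) (rho X1 s : R) :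
  (s == 1) || (s == -1) -> 0 < rho ->
  (forall t, D t -> `|d1 t| <= rho `^ t) ->
  (forall t, D t -> `|d2 t| <= rho `^ t) ->
  (forall x, X1 <= s * x ->
    sum_over D (fun t => d2 t * (s * x) `^ (- (t + 1))) = (h x)%:E) ->
  (forall A : set (measurableTypeR R), measurable A ->
    A `<=` [set x | X1 <= s * x] -> leb.-integrable A (EFin \o h)) ->
  (forall A : set (measurableTypeR R), measurable A ->
    A `<=` [set x | X1 <= s * x] ->
    (\int[leb]_(x in A) (h x)%:E = \int[leb]_(x in A)
       sum_over D (fun t => (d1 t * (s * x) `^ (- (t + 1)))%R))%E) ->
  forall t, D t -> d1 t = d2 t.
Proof.
move=> s1 rho0 H1 H2 hE inth intE t Dt; apply: contrapT => /eqP dt.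
have [X0 HX] := expansion_separation alpha_gt0 alpha_irr rho0 H1 H2
  (ex_intro2 _ _ t Dt dt).
pose X := Num.max X0 X1.
have X0X : X0 <= X by rewrite le_max lexx.
have X1X : X1 <= X by rewrite le_max lexx orbT.
have [de de0 sep] := HX X X0X.
(* With this left endpoint, [x -> s x] maps [[a, a + 1]] onto [[X, X + 1]] for either sign. *)
pose a := if s == 1 then X else - X - 1.
pose A : set (measurableTypeR R) := [set` `[a, a + 1]].
have mA : measurable A by exact: measurable_itv.
have AX x : A x -> X <= s * x <= X + 1.
  rewrite /A/= in_itv/= /a; case/orP: s1 => /eqP ->.
    by rewrite eqxx mul1r.
  rewrite [_ == _](_ : _ = false); first by rewrite mulN1r; lra.
  by apply/negP => /eqP ?; lra.
have AX1 : A `<=` [set x | X1 <= s * x].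
  by move=> x /AX /andP[+ _]; exact: le_trans.
have A1 : leb A = 1%E.
  rewrite lebesgue_measure_itv/= lte_fin ltrDl ltr01.
  by rewrite -EFinD addrAC subrr add0r.
have A0 : (0 < leb A)%E by rewrite A1.
have Afin : (leb A < +oo)%E by rewrite A1 ltry.
have := intE A mA AX1.
(* Either way the two integrals over [A] differ strictly, against [intE]. *)
case: sep => sep.
  suff /lt_eqF/eqP : (\int[leb]_(x in A) (h x)%:E < \int[leb]_(x in A)
      sum_over D (fun t => (d1 t * (s * x) `^ (- (t + 1)))%R))%E by [].
  apply: (lt_integral_above mA A0 Afin de0 (inth A mA AX1)) => x Ax.
  by rewrite /= -hE; [exact/sep/AX|exact: AX1].
suff /gt_eqF/eqP : (\int[leb]_(x in A)
    sum_over D (fun t => (d1 t * (s * x) `^ (- (t + 1)))%R) <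
    \int[leb]_(x in A) (h x)%:E)%E by [].
apply: (lt_integral_below mA A0 Afin de0 (inth A mA AX1)) => x Ax.
by rewrite /= -hE; [exact/sep/AX|exact: AX1].
Qed.

End uniqueness.

(** * The counterexample inside D *)

Lemma normc_ge (R : realType) (z : R[i]) (w : R) :
  (`|z| <= w%:C)%C -> complex.Re z ^+ 2 + complex.Im z ^+ 2 <= w ^+ 2.
Proof.
rewrite normc_def lecR => H.
rewrite -[leLHS]sqr_sqrtr ?addr_ge0 ?sqr_ge0//.
by rewrite lerXn2r ?nnegrE ?sqrtr_ge0// (le_trans _ H)// sqrtr_ge0.
Qed.

Lemma normr_le_of_sqr (R : realType) (x w : R) :
  0 <= w -> x ^+ 2 <= w ^+ 2 -> `|x| <= w.
Proof.
by move=> w0; rewrite -(real_normK (num_real x)) ler_pXn2r ?nnegrE.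
Qed.

(* Cauchy-Schwarz against the unit vector [(sin, cos)]. *)
Lemma rotation_le (R : realType) (u v w th : R) : 0 <= w ->
  u ^+ 2 + v ^+ 2 <= w ^+ 2 -> `|u * sin th + v * cos th| <= w.
Proof.
move=> w0 uv; apply: normr_le_of_sqr => //; apply: le_trans uv.
rewrite -[leRHS]mulr1 -(cos2Dsin2 th) -subr_ge0.
rewrite [leRHS](_ : _ = (u * cos th - v * sin th) ^+ 2) ?sqr_ge0//.
by ring.
Qed.

Lemma natr_le_expn2 (R : realType) (q : nat) : q%:R <= 2 ^+ q :> R.
Proof. by rewrite -natrX ler_nat ltnW// ltn_expl. Qed.

(** Multiplying an approximation of [alpha] by [q] and [pi] costs only exponential factors, which a
    larger base in the definition of [in_D] absorbs. *)
Lemma in_D_approx (R : realType) (alpha M : R) : in_D alpha -> 0 < M ->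
  exists (p : int) (q : nat), (0 < q)%N /\
    M ^+ q * (`|q%:R * alpha - p%:~R| * pi) < 1.
Proof.
(* [B^q] is [8^q (M + 1)^q]: one factor [2^q] pays for [q], two more for [pi], and [(M + 1)^q]
   strictly exceeds [M^q]. *)
move=> [_ Hinf] M0; pose B := 8 * (M + 1).
have B1 : 1 < B by rewrite /B; lra.
have B0 : 0 < B by lra.
have [[p q] /= [q0 pq]] : [set pq : int * nat |
    (0 < pq.2)%N /\ `|alpha - pq.1%:~R / pq.2%:R| < B ^- pq.2] !=set0.
  by apply/set0P; apply/eqP => E; apply: (Hinf B B1); rewrite E.
exists p, q; split=> //.
have q0R : 0 < q%:R :> R by rewrite ltr0n.
have -> : q%:R * alpha - p%:~R = q%:R * (alpha - p%:~R / q%:R).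
  by field; rewrite gt_eqF.
rewrite normrM (gtr0_norm q0R).
have Mq0 : 0 < M ^+ q by rewrite exprn_gt0.
have q2 := natr_le_expn2 R q.
have [/andP[_ ph2] _] := pihalf_02_cos_pihalf R.
have p4 : pi <= 2 ^+ q * 2 :> R.
  have : 2 <= 2 ^+ q :> R by rewrite -[leLHS]expr1 ler_weXn2l// ler1n.
  lra.
have BE : B ^+ q = 2 ^+ q * (2 ^+ q * 2 ^+ q) * (M + 1) ^+ q.
  by rewrite -!exprMn /B; congr (_ ^+ _); ring.
have MM1 : M ^+ q < (M + 1) ^+ q by rewrite ltr_pXn2r ?nnegrE//; lra.
have Bq0 : 0 < B ^+ q by rewrite exprn_gt0.
apply: (@le_lt_trans _ _ (M ^+ q * (2 ^+ q * B ^- q * (2 ^+ q * 2 ^+ q)))).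
  rewrite ler_wpM2l ?(ltW Mq0)//; apply: ler_pM.
  - by rewrite mulr_ge0 ?(ltW q0R).
  - exact: pi_ge0.
  - by apply: ler_pM => //; exact: ltW.
  - apply: (le_trans p4); rewrite ler_wpM2l ?exprn_ge0//.
    by rewrite -[leLHS]expr1 ler_weXn2l// ler1n.
have -> : M ^+ q * (2 ^+ q * B ^- q * (2 ^+ q * 2 ^+ q)) =
   (M ^+ q * (2 ^+ q * (2 ^+ q * 2 ^+ q))) / B ^+ q by ring.
rewrite ltr_pdivrMr// mul1r BE mulrC ltr_pM2l// !mulr_gt0// exprn_gt0//.
Qed.

Lemma multiples_pos_nat (R : realType) (alpha : R) (n : nat) :
  irrational alpha ->
  \1_(multiples_pos alpha) n%:R = 0 :> R.
Proof.
move=> alpha_irr; rewrite indicE memNset// => -[k _ /= kn].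
have := @irrational_mul_neq_int _ alpha n k.+1 alpha_irr (ltn0Sn _).
by rewrite kn eqxx.
Qed.

(** Membership in [class_P] would force [|a t|^2 sin(t pi)^2 = 1] at every [t = q alpha] with
    [q >= 1], while [|a t| <= r^t] and [|sin(t pi)| <= pi |q alpha - p|]. For a good enough
    approximation [p / q] the product is below 1. *)
Lemma in_D_counterexample (R : realType) (alpha c : R) :
  0 < alpha -> 0 < c -> in_D alpha ->
  exists mu : probability (measurableTypeR R) R,
    [/\ class_PB (S_ alpha) c mu,
        (exists (b : R -> R) (r R0 : R),
           right_expansion (S_ alpha) c mu b r R0 /\
           (forall n : nat, (0 < n)%N -> b n%:R = 0)) &
        ~ class_P (S_ alpha) c mu].
Proof.
move=> a0 c0 aD; have alpha_irr := aD.1.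
(* The root secures the tail condition [Hx0], [c] the radius inequality with [r = 1], and 1 the
   bound [x0 > 1]. *)
pose x0 := (2 + 2 / alpha) `^ alpha^-1 + c + 1.
have p0 : 0 <= (2 + 2 / alpha) `^ alpha^-1 by exact: powR_ge0.
have x01 : 1 < x0 by rewrite /x0; lra.
have a2 : 0 < 2 + 2 / alpha by rewrite addr_gt0// divr_gt0.
have Hx0 : 2 + 2 / alpha <= x0 `^ alpha.
  have -> : 2 + 2 / alpha = ((2 + 2 / alpha) `^ alpha^-1) `^ alpha.
    by rewrite -powRrM mulVf ?gt_eqF// powRr1// ltW.
  rewrite ge0_ler_powR ?nnegrE ?(ltW a0)//; last by rewrite /x0; lra.
  by apply: ltW; apply: lt_trans x01.
have [mu [mu_neg dens]] := geom_probability a0 x01 Hx0.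
pose D := S_ alpha `&` [set t | 0 < t].
pose b t : R := \1_(multiples_pos alpha) t.
have x00 : 0 < x0 by apply: lt_trans x01.
have b1 t : `|b t| <= 1.
  by rewrite /b indicE; case: (t \in _); rewrite ?normr1 ?normr0.
have rexp : right_expansion (S_ alpha) c mu b 1 x0.
  split => //.
  - by rewrite mulrC ltr_pdivlMr// mul1r /x0; lra.
  - by move=> t _ _; rewrite powR1.
  - move=> A mA; rewrite dens//; apply: eq_integral => x.
    rewrite inE => -[_ /= xx0].
    have x1 := lt_le_trans x01 xx0; have xp := lt_trans ltr01 x1.
    rewrite -(geom_density_series a0 x1); congr sum_over; apply/funext => t.
    by rewrite -(powR_inv1 (ltW xp)) -powRrM mulN1r.
exists mu; split.
- split; last by exists b, 1, x0.
  exists 0 => x sx; rewrite leNgt; apply/negP => xlt0.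
  have E : [set` `]-oo, 0[] = [set y : R | y < 0].
    by apply/seteqP; split => y /=; rewrite in_itv.
  by have := sx _ (@open_lt _ 0) xlt0; rewrite -E mu_neg ltxx.
- by exists b, 1, x0; split=> // n n0; exact: multiples_pos_nat.
move=> [a [r [R0 [[r0 R00] _ ar adens]]]].
pose rho := Num.max 1 r.
have rho1 : 1 <= rho by rewrite le_max lexx.
have rrho : r <= rho by rewrite le_max lexx orbT.
have rho0 : 0 < rho := lt_le_trans ltr01 rho1.
have anorm t : D t ->
    complex.Re (a t) ^+ 2 + complex.Im (a t) ^+ 2 <= (r `^ t) ^+ 2.
  by move=> [St t0]; apply: normc_ge; exact: ar.
have rrhot t : D t -> r `^ t <= rho `^ t.
  by move=> [_ /ltW t0]; rewrite ge0_ler_powR ?nnegrE ?(ltW r0) ?(ltW rho0).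
pose X1 := x0 + R0.
have aIm t : D t -> complex.Im (a t) = b t.
  move: t; apply: (expansion_unique a0 alpha_irr
    (d1 := fun t => complex.Im (a t)) (h := geom_density alpha)
    (rho := rho) (X1 := X1) (s := 1)) => //.
  - by rewrite eqxx.
  - move=> u Du; apply: le_trans (rrhot u Du).
    apply: normr_le_of_sqr; first exact: powR_ge0.
    by apply: le_trans (anorm u Du); rewrite lerDr sqr_ge0.
  - by move=> u [_ u0]; apply: (le_trans (b1 u)); rewrite powR_ge1// ltW.
  - move=> x; rewrite mul1r => Xx; apply: geom_density_series => //.
    by apply: lt_le_trans x01 _; move: Xx; rewrite /X1; lra.
  - move=> A mA AX; apply/integrableP; split.
      apply/measurable_EFinP; apply: measurable_funTS.
      exact: measurable_geom_density.
    have AE : A `&` [set x | x0 <= x] = A.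
      by apply/setIidPl => x /AX /=; rewrite mul1r /X1; lra.
    (* The integral is at most 1, being the mass of [A]. *)
    rewrite [ltLHS](_ : _ = mu A).
      by rewrite (le_lt_trans (probability_le1 _ mA))// ltry.
    rewrite -[in RHS]AE [RHS](dens A mA) AE; apply: eq_integral => x _.
    by rewrite gee0_abs// lee_fin geom_density_ge0.
  - move=> A mA AX.
    have AE : A `&` [set x | x0 <= x] = A.
      by apply/setIidPl => x /AX /=; rewrite mul1r /X1; lra.
    have AE' : A `&` [set x | R0 <= `|x|] = A.
      apply/setIidPl => x /AX /=; rewrite mul1r /X1 => H.
      by apply: le_trans (ler_norm _); lra.
    have := dens A mA; rewrite AE => <-.
    have := adens A mA; rewrite AE' => ->.
    apply: eq_integral => x; rewrite inE => /AX /=; rewrite !mul1r /X1 => H.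
    congr sum_over; apply/funext => t.
    by rewrite Im_inv_cpow ifT//; lra.
(* The coefficient of [|x|^(-(t+1))] on the negative half-line; [mu] has no mass there, so it is
   compared with the zero expansion. *)
pose e t := complex.Re (a t) * sin ((t + 1) * pi) +
  complex.Im (a t) * cos ((t + 1) * pi).
have e0 t : D t -> e t = 0.
  move: t; apply: (expansion_unique a0 alpha_irr (d1 := e) (d2 := cst 0)
    (h := cst 0) (rho := rho) (X1 := X1) (s := -1)) => //.
  - by rewrite eqxx orbT.
  - move=> u Du; apply: le_trans (rrhot u Du).
    by apply: rotation_le; [exact: powR_ge0|exact: anorm].
  - by move=> u _; rewrite /= normr0 powR_ge0.
  - move=> x _; rewrite /sum_over !esum1 ?sube0// => u _;
      rewrite ?funeposE ?funenegE /= mul0r.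
      by rewrite oppr0 [LHS]maxxx.
    by rewrite [LHS]maxxx.
  - by move=> A mA AX; exact: integrable0.
  - move=> A mA AX.
    have Aneg : A `<=` [set` `]-oo, 0[].
      by move=> x /AX /=; rewrite in_itv/= mulN1r /X1; lra.
    have AE' : A `&` [set x | R0 <= `|x|] = A.
      apply/setIidPl => x /AX /=; rewrite mulN1r /X1 => H.
      by rewrite -normrN; apply: le_trans (ler_norm _); lra.
    have muA : mu A = 0%E.
      by apply: (subset_measure0 mA _ Aneg mu_neg); exact: measurable_itv.
    have := adens A mA; rewrite AE' muA integral0 => ->.
    apply: eq_integral => x; rewrite inE => /AX /=; rewrite mulN1r /X1 => H.
    have x0' : x < 0 by lra.
    congr sum_over; apply/funext => t.
    by rewrite Im_inv_cpow leNgt x0'/= ltr0_norm.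
(* Taking [M = r^alpha] turns [M^q] into [r^t] for [t = q alpha]. *)
have [p [q [q0 pq]]] := in_D_approx aD (powR_gt0 alpha r0).
pose t := q%:R * alpha.
have Dt : D t.
  split; first by exists 0%N, q; rewrite add0r.
  by rewrite /= mulr_gt0// ltr0n.
have bt : b t = 1.
  rewrite /b indicE mem_set//; exists q.-1 => //=.
  by rewrite prednK.
have := e0 t Dt; have := anorm t Dt; rewrite /e aIm// bt mul1r expr1n.
set S := sin _; set C := cos _; set u := complex.Re _ => unorm uS.
have CS : C ^+ 2 + S ^+ 2 = 1 by rewrite cos2Dsin2.
(* [e t = 0] reads [C = -u S], and [C^2 + S^2 = 1]. *)
have S1 : (u ^+ 2 + 1) * S ^+ 2 = 1.
  by rewrite -[RHS]CS (_ : C = - (u * S)); [ring|lra].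
(* The angle [(t + 1) pi] differs from [(t - p) pi] by [p + 1] half-turns. *)
have SE : S ^+ 2 = sin ((t - p%:~R) * pi) ^+ 2.
  rewrite -(sin_sqr_shift ((t - p%:~R) * pi) (p + 1)) /S; congr (sin _ ^+ 2).
  by rewrite intrD; ring.
have Sle : S ^+ 2 <= (`|t - p%:~R| * pi) ^+ 2.
  rewrite SE -real_normK ?num_real// lerXn2r ?nnegrE ?mulr_ge0 ?pi_ge0//.
  by apply: (le_trans (abs_sin_le _)); rewrite normrM (ger0_norm (pi_ge0 R)).
move: pq; rewrite -powR_mulrn ?powR_ge0// -powRrM mulrC [alpha * _]mulrC -/t.
set y := _ * pi => ry.
have y0 : 0 <= y by rewrite mulr_ge0 ?pi_ge0.
have : 1 <= (r `^ t * y) ^+ 2.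
  by rewrite -S1 exprMn; apply: ler_pM => //; rewrite ?addr_ge0 ?sqr_ge0.
apply/negP; rewrite -ltNge expr_lt1 ?(mulr_ge0 (powR_ge0 _ _) y0)//.
by rewrite mulrC.
Qed.

Theorem theorem2p13 (R : realType) (alpha c : R)
    (alpha_gt0 : 0 < alpha) (Sc : admissible (S_ alpha) c) :
  (~ in_D alpha ->
   forall mu : probability (measurableTypeR R) R,
     class_PB (S_ alpha) c mu ->
     forall (b : R -> R) (r R0 : R),
       right_expansion (S_ alpha) c mu b r R0 ->
       (forall n : nat, (0 < n)%N -> b n%:R = 0) ->
       class_P (S_ alpha) c mu)
  /\
  (in_D alpha ->
   exists mu : probability (measurableTypeR R) R,
     [/\ class_PB (S_ alpha) c mu,
         (exists (b : R -> R) (r R0 : R),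
            right_expansion (S_ alpha) c mu b r R0 /\
            (forall n : nat, (0 < n)%N -> b n%:R = 0)) &
         ~ class_P (S_ alpha) c mu]).
Proof.
have [c_gt0 _ _ _ _] := Sc; split.
  exact: vanishing_nat_coef_class_P.
exact: in_D_counterexample.
Qed.
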